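(* Let $Q$ be a near prequantale and $a\in Q$, and let $v(a)$ be the divisorial closure on $Q$ with respect to $a$. Then $$x^{v(a)}=\bigvee\{y\in Q:\ \forall f\in\mathrm{Lin}(Q)\ (f(x)\le a\Rightarrow f(y)\le a)\}$$ for all $x\in Q$; alternatively, $x^{v(a)}$ is the largest element of $Q$ such that $f(x)\le a$ implies $f(x^{v(a)})\le a$ for all $f\in\mathrm{Lin}(Q)$.
   Context: A near prequantale is a magma $Q$ (not assumed associative, commutative or unital) with a partial order compatible with multiplication ($x\le x'$, $y\le y'$ imply $xy\le x'y'$) such that for every nonempty subset $X$ of $Q$, $\bigvee X$ exists and $a(\bigvee X)=\bigvee(aX)$, $(\bigvee X)a=\bigvee(Xa)$ for all $a\in Q$. A closure operation on a poset is an expansive, order-preserving, idempotent self-map; a nucleus on an ordered magma is a closure operation $\star$ with $x^\star y^\star\le(xy)^\star$ for all $x,y$ (where $x^\star=\star(x)$). Nuclei are ordered pointwise; larger means coarser. For an element $a$ of an ordered magma $M$, $v(a)$ denotes the coarsest nucleus $\star$ on $M$ such that $a^\star=a$, if it exists; it exists for every element of a near prequantale. For $r\in Q$, the translations $L_r,R_r:Q\to Q$ are $L_r(x)=rx$ and $R_r(x)=xr$; $\mathrm{Lin}(Q)$ is the submonoid (containing the identity map) generated by all translations of the monoid of all self-maps of $Q$ under composition. *)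

(* Defs.v *)
From HB Require Import structures.
From mathcomp Require Import all_boot all_order.
From mathcomp Require Import boolp classical_sets.

Set Implicit Arguments.
Unset Strict Implicit.
Unset Printing Implicit Defensive.

Import Order.TTheory.

Local Open Scope classical_set_scope.
Local Open Scope group_scope.
Local Open Scope order_scope.

HB.mixin Record isOrderedMagma (d : Order.disp_t) Q
    of Magma Q & Order.POrder d Q := {
  le_mulg : forall x x' y y' : Q, x <= x' -> y <= y' -> x * y <= x' * y'
}.

#[short(type="orderedMagmaType")]
HB.structure Definition OrderedMagma (d : Order.disp_t) :=
  { Q of Magma Q & Order.POrder d Q & isOrderedMagma d Q }.

                                                            
HB.mixin Record isNearPrequantale (d : Order.disp_t) Q of OrderedMagma d Q := {
  nonempty_join : forall X : set Q, X !=set0 -> exists s, isLub X s;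
  mulg_join : forall (a : Q) (X : set Q) (s : Q),
    X !=set0 -> isLub X s -> isLub [set a * x | x in X] (a * s);
  join_mulg : forall (a : Q) (X : set Q) (s : Q),
    X !=set0 -> isLub X s -> isLub [set x * a | x in X] (s * a)
}.

#[short(type="nearPrequantaleType")]
HB.structure Definition NearPrequantale (d : Order.disp_t) :=
  { Q of OrderedMagma d Q & isNearPrequantale d Q }.

Definition closure_operation (d : Order.disp_t) (P : porderType d)
    (c : P -> P) : Prop :=
  [/\ forall x, x <= c x,
      {homo c : x y / x <= y} &
      forall x, c (c x) = c x].

Definition nucleus (d : Order.disp_t) (M : orderedMagmaType d)
    (c : M -> M) : Prop :=
  closure_operation c /\ forall x y, c x * c y <= c (x * y).

Definition coarsest_nucleus_fixing (d : Order.disp_t) (M : orderedMagmaType d)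
    (a : M) (c : M -> M) : Prop :=
  [/\ nucleus c, c a = a &
      forall c' : M -> M, nucleus c' -> c' a = a -> forall x, c' x <= c x].

                                                                             
                                                            
Definition divisorial_closure (d : Order.disp_t) (M : orderedMagmaType d)
    (a : M) : M -> M :=
  xget (@id M : M -> M) [set c | coarsest_nucleus_fixing a c].

Definition ltrans (Q : magmaType) (r : Q) : Q -> Q := fun x => r * x.

Definition rtrans (Q : magmaType) (r : Q) : Q -> Q := fun x => x * r.

Definition self_map_submonoid (T : Type) (S : set (T -> T)) : Prop :=
  S id /\ forall f g, S f -> S g -> S (f \o g).

Definition Lin (Q : magmaType) : set (Q -> Q) :=
  smallest (@self_map_submonoid Q) (range (@ltrans Q) `|` range (@rtrans Q)).

Arguments Lin Q : clear implicits.

(* Main.v *)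
(** Elements of [Lin Q] preserve joins of nonempty sets, so the join of
    [D x := {y | forall f in Lin Q, f x <= a -> f y <= a}], a set which contains
    [x], again lies in [D x]. Hence [x |-> max (D x)] is a nucleus fixing [a].
    It is the coarsest one: if [c] is a nucleus with [c a = a], then
    [f (c x) <= c (f x)] for all [f] in [Lin Q], so [c x] is in [D x]. *)
Require Import Defs.
From HB Require Import structures.
From mathcomp Require Import all_boot all_order.
From mathcomp Require Import boolp classical_sets.

Set Implicit Arguments.
Unset Strict Implicit.
Unset Printing Implicit Defensive.

Import Order.TTheory.

Local Open Scope classical_set_scope.
Local Open Scope order_scope.

Section LinTheory.
Variable Q : magmaType.

Lemma Lin_id : Lin Q id.
Proof. by move=> S [[S1 _] _]. Qed.

Lemma Lin_comp (f g : Q -> Q) : Lin Q f -> Lin Q g -> Lin Q (f \o g).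
Proof.
move=> Lf Lg S SP; have [[_ SM] _] := SP.
exact: SM (Lf S SP) (Lg S SP).
Qed.

Lemma Lin_ltrans (r : Q) : Lin Q (ltrans r).
Proof. by move=> S [_ gS]; apply: gS; left; exists r. Qed.

Lemma Lin_rtrans (r : Q) : Lin Q (rtrans r).
Proof. by move=> S [_ gS]; apply: gS; right; exists r. Qed.

Lemma Lin_ind (S : set (Q -> Q)) :
  S id -> (forall f g, S f -> S g -> S (f \o g)) ->
  (forall r, S (ltrans r)) -> (forall r, S (rtrans r)) ->
  forall f, Lin Q f -> S f.
Proof. by move=> S1 SM Sl Sr f; apply; split=> // g [] [r _ <-]. Qed.

End LinTheory.

Lemma Lin_homo (d : Order.disp_t) (Q : orderedMagmaType d) (f : Q -> Q) :
  Lin Q f -> {homo f : x y / x <= y}.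
Proof.
move: f; apply: Lin_ind => //.
- by move=> f g hf hg x y /hg /hf.
- by move=> r x y xy; apply: le_mulg.
- by move=> r x y xy; apply: le_mulg.
Qed.

(** For a left translation, [r <= c r] yields [r * c x <= c r * c x <= c (r * x)]; right
    translations are symmetric. *)
Lemma Lin_nucleus (d : Order.disp_t) (Q : orderedMagmaType d) (c f : Q -> Q) :
  nucleus c -> Lin Q f -> forall x, f (c x) <= c (f x).
Proof.
move=> [[cge cle _] cM] Lf.
(* Monotonicity is carried through the induction because a composite applies [f] to the inequality
   [g (c x) <= c (g x)]. *)
suff [_ cf] : {homo f : x y / x <= y} /\ forall x, f (c x) <= c (f x)
  by exact: cf.
move: f Lf; apply: (@Lin_ind Q (fun f =>
  {homo f : x y / x <= y} /\ forall x, f (c x) <= c (f x))).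
- by split.
- move=> f g [hf cf] [hg cg]; split=> [x y /hg /hf // | x /=].
  exact: le_trans (hf _ _ (cg x)) (cf _).
- move=> r; split=> [x y xy | x]; first exact: le_mulg.
  by apply: le_trans (cM r x); apply: le_mulg.
- move=> r; split=> [x y xy | x]; first exact: le_mulg.
  by apply: le_trans (cM x r); apply: le_mulg.
Qed.

Section DivisorialClosure.
Variables (d : Order.disp_t) (Q : nearPrequantaleType d).

Lemma Lin_isLub (f : Q -> Q) : Lin Q f ->
  forall (X : set Q) (s : Q), X !=set0 -> isLub X s -> isLub (f @` X) (f s).
Proof.
move: f; apply: Lin_ind.
- by move=> X s _; rewrite image_id.
- move=> f g hf hg X s X0 /(hg _ _ X0) lubg.
  by rewrite -image_comp; apply: hf => //; apply: image_nonempty.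
- by move=> r X s; apply: mulg_join.
- by move=> r X s; apply: join_mulg.
Qed.

Variable a : Q.

Let D (x : Q) : set Q :=
  [set y | forall f : Q -> Q, Lin Q f -> f x <= a -> f y <= a].

Let c (x : Q) : Q := xget x [set s | isLub (D x) s].

(** Since [x] lies in [D x], the join exists and the default value of [xget] is never taken. *)
Let cP x : isLub (D x) (c x).
Proof.
apply: (xgetPex x (P := [set s | isLub (D x) s])).
by apply: nonempty_join; exists x.
Qed.

Let c_ge x y : D x y -> y <= c x.
Proof. by move=> Dxy; have [+ _] := cP x; apply. Qed.

(** When [f x <= a], the bound [a] dominates the image of [D x] under [f], whose join is
    [f (c x)]. *)
Let c_mem x : D x (c x).
Proof.
move=> f Lf fxa.
have [_] : isLub (f @` D x) (f (c x)).
  by apply: Lin_isLub (cP x) => //; exists x.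
by apply=> _ [y Dxy <-]; apply: Dxy.
Qed.

Let c_coarsest : coarsest_nucleus_fixing a c.
Proof.
split.
- split; first split.
  + by move=> x; apply: c_ge.
  + move=> x y xy; apply: c_ge => f Lf fya.
    by apply: c_mem => //; apply: le_trans fya; apply: Lin_homo.
  (* Membership in [D] is transitive: [c (c x)] is in [D (c x)] and [c x] is in [D x]. *)
  + move=> x; apply/le_anti/andP; split; last exact: c_ge.
    by apply: c_ge => f Lf fxa; apply: c_mem => //; apply: c_mem.
  + move=> x y; apply: c_ge => f Lf fxya.
    (* The factors are closed one at a time: [f (x * y) <= a] gives [f (c x * y) <= a], which gives
       [f (c x * c y) <= a]. *)
    apply: (@c_mem y _ (Lin_comp Lf (Lin_ltrans (c x)))).
    exact: (@c_mem x _ (Lin_comp Lf (Lin_rtrans y))).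
- apply/le_anti/andP; split; last exact: c_ge.
  exact: (@c_mem a _ (@Lin_id Q) (lexx a)).
- move=> c' c'N c'a x; apply: c_ge => f Lf fxa.
  (* The chain is [f (c' x) <= c' (f x) <= c' a = a]. *)
  apply: le_trans (Lin_nucleus c'N Lf x) _.
  by have [[_ c'le _] _] := c'N; rewrite -c'a; apply: c'le.
Qed.

Lemma divisorial_closure_max x :
  isLub (D x) (divisorial_closure a x) /\ D x (divisorial_closure a x).
Proof.
(* The map [c] witnesses that a coarsest nucleus exists, so [xget] does not fall back on [id]; two
   coarsest nuclei bound each other pointwise and hence agree. *)
suff -> : divisorial_closure a x = c x by split; [exact: cP | exact: c_mem].
have [dN da dmax] : coarsest_nucleus_fixing a (divisorial_closure a).
  apply: (xgetPex _ (P := [set c | coarsest_nucleus_fixing a c])).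
  by exists c.
have [cN ca cmax] := c_coarsest.
by apply/le_anti; rewrite cmax //= dmax.
Qed.

End DivisorialClosure.

Theorem proposition8p8 (d : Order.disp_t) (Q : nearPrequantaleType d) (a x : Q) :
  isLub [set y : Q | forall f : Q -> Q, Lin Q f -> f x <= a -> f y <= a]
    (divisorial_closure a x)
  /\
  ((forall f : Q -> Q, Lin Q f -> f x <= a -> f (divisorial_closure a x) <= a)
   /\
   (forall z : Q, (forall f : Q -> Q, Lin Q f -> f x <= a -> f z <= a) ->
      z <= divisorial_closure a x)).
Proof.
have [lubD Dd] := divisorial_closure_max a x.
by split=> //; split=> //; have [] := lubD.
Qed.
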